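(* Let $k$ and $m$ be positive integers. For any semi-online colouring algorithm that $k$-colours the vertices of an arborescence in a leaf-to-root order, there is an arborescence that has a leaf-to-root order such that, when its vertices are presented to the algorithm in this order, the algorithm will produce (at some step) a directed path of length $m$ that contains at most one colour.
   Context: An arborescence is a finite directed tree with a distinguished root vertex such that all edges are directed away from the root, i.e. there is a unique directed path from the root to any vertex. A disjoint union of arborescences is a branching. The length of a directed path is its number of edges. A leaf-to-root order of a branching is a linear order in which the vertices are presented so that every vertex is preceded by all its out-neighbours and succeeded by its in-neighbour (if any). Thus at each step the presented vertices induce a branching, and the newly presented vertex is a root of it. A semi-online $k$-colouring algorithm receives the vertices one by one in the given order, each together with its edges to the previously presented vertices, and without knowledge of the future. After each new vertex it may assign one of $k$ colours to any of the presented, not yet coloured vertices (it may leave vertices uncoloured and colour them later); colours are irrevocable. So after every step there is a partial $k$-colouring of the presented vertices, determined by what has been presented so far, and each partial colouring extends the previous one. A path of presented vertices contains at most one colour (at a step) if at most one colour is currently used on its coloured vertices; uncoloured vertices contribute no colour. *)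

(* Defs.v *)
From mathcomp Require Import all_boot.

Set Implicit Arguments.
Unset Strict Implicit.
Unset Printing Implicit Defensive.

(** A finite digraph is an arc relation [e : rel T] on a finite type. *)
Section Digraphs.
Variables (T : finType) (e : rel T).

(** [is_dipath x p]: the vertex sequence [x :: p] is a directed path; its
    length is [size p]. *)
Definition is_dipath (x : T) (p : seq T) : Prop :=
  path e x p /\ uniq (x :: p).

Definition underlying : rel T := [rel x y | e x y || e y x].

(** The first clause says that [e] is an orientation of its underlying simple
    graph; it excludes both loops and pairs of opposite arcs, so the cycles of
    the underlying graph are its cyclic sequences of at least 3 vertices. *)
Definition directed_tree : Prop :=
  [/\ forall x y, e x y -> ~~ e y x,
      forall x y, connect underlying x y
    & forall p, cycle underlying p -> uniq p -> size p <= 2].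

Definition arborescence : Prop :=
  directed_tree /\
  exists r : T, forall v : T, exists! p : seq T, is_dipath r p /\ last r p = v.

Definition leaf_to_root_order (n : nat) (s : n.-tuple T) : Prop :=
  [/\ uniq s,
      forall x, x \in s
    & forall i j : 'I_n, e (tnth s i) (tnth s j) -> j < i].

(** What has been presented after [j] steps when the vertices arrive in the
    order [s]: vertices are known by their arrival times [0, ..., j - 1], and
    the arcs among them are known. *)
Definition presented (n : nat) (s : n.-tuple T) (j : nat) (le_jn : j <= n) :
    rel 'I_j :=
  fun a b => e (tnth s (widen_ord le_jn a)) (tnth s (widen_ord le_jn b)).

End Digraphs.

(** [colouring A h] is the partial colouring kept by the algorithm [A] after
    the [j] steps recorded in [h : rel 'I_j] ([None] means uncoloured).  Only
    the values at histories arising from arborescences presented in a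
    leaf-to-root order are meaningful. *)
Record semi_online_algorithm (k : nat) := SemiOnlineAlgorithm {
  colouring : forall j : nat, rel 'I_j -> 'I_j -> option 'I_k;
  colouring_irrevocable :
    forall (T : finType) (e : rel T) (n : nat) (s : n.-tuple T),
      arborescence e -> leaf_to_root_order e s ->
      forall (j : nat) (lt_jn : j < n) (v : 'I_j) (c : 'I_k),
        colouring (presented e s (ltnW lt_jn)) v = Some c ->
        colouring (presented e s lt_jn) (widen_ord (leqnSn j) v) = Some c
}.

Definition at_most_one_colour (V C : eqType) (f : V -> option C) (p : seq V) :
    Prop :=
  forall (u v : V) (c d : C),
    u \in p -> v \in p -> f u = Some c -> f v = Some d -> c = d.

(* Main.v *)
Require Import Defs.
From mathcomp Require Import all_boot.
From Stdlib Require Import FunctionalExtensionality.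

Set Implicit Arguments.
Unset Strict Implicit.
Unset Printing Implicit Defensive.

(** Present a vertex [x] and record its profile: the unfolding of the tree below
    [x] to depth [m], each vertex labelled by its colour (or absence of colour)
    at the time [x] arrives, with children of equal profile identified.  For
    fixed [m] there are only finitely many profiles, and a profile, being
    recorded once and for all, is not affected by what the algorithm does
    later.

    Suppose that some vertex [x0] has a child [x1] with the same profile
    ([has_twins]).  Each profile contains the set of the profiles one level
    below, so the child [x1] of [x0] is matched by some child [x2] of [x1], then
    [x2] by some child [x3] of [x2], and so on.  This yields a path in which the
    colour of [x_i] when [x0] arrives equals the colour of [x_(i+1)] when [x1]
    arrived, for every [i <= m].  If [x_i] has colour [c] when [x0] arrives,
    then [x_(i+1)] had colour [c] already when [x1] arrived, and it still has
    it when [x0] arrives, as colours are irrevocable.  So colours propagate down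
    the path, every coloured vertex of [x_0, ..., x_m] has the colour of [x_m],
    and this path of length [m] has at most one colour when [x0] arrives
    ([twins_one_colour_path]).

    It remains to force such twins.  The adversary produces [t] roots with
    distinct profiles, by induction on [t] ([force_distinct_roots]): it plays the
    strategy for [t] twice, disjointly, obtaining families of roots [R1] and
    [R2].  If some profile in [R2] is absent from [R1], adding that root to [R1]
    gives [t + 1] distinct profiles.  Otherwise a new vertex is placed above all
    of [R1]; either its profile equals that of one of its children, giving
    twins, or it is absent from [R1], hence from [R2], and the new vertex can be
    added to [R2].  When [t] exceeds the number of profiles, only the case of
    twins remains.  A last vertex above all the roots turns the branching into
    an arborescence. *)

(** * Arborescences from unique parents *)

Lemma height_path (T : eqType) (e : rel T) (height : T -> nat) x p :
    (forall a b, e a b -> height b < height a) -> path e x p ->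
  all (fun y => height y < height x) p.
Proof.
move=> height_arc; elim: p x => //= y p IHp x /andP[exy /IHp lt_p].
rewrite height_arc //=.
by apply: sub_all lt_p => z lt_zy; apply: ltn_trans lt_zy (height_arc _ _ exy).
Qed.

Section UniqueParents.
Variables (T : finType) (e : rel T) (height : T -> nat) (r : T).
Hypothesis height_arc : forall a b, e a b -> height b < height a.
Hypothesis parent_unique : forall a a' b, e a b -> e a' b -> a = a'.
Hypothesis parent_exists : forall b, b != r -> exists a, e a b.

Lemma path_is_dipath x p : path e x p -> is_dipath e x p.
Proof.
move=> e_p; split=> //; elim: p x e_p => //= y p IHp x /andP[exy e_p].
have /allP lt_x: all (fun z => height z < height x) (y :: p).
  by apply: height_path height_arc _; rewrite /= exy.
by move: (IHp y e_p) => /= ->; rewrite andbT; apply/negP=> /lt_x; rewrite ltnn.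
Qed.

(** Climbing from [v] through parents gains height at each step, so it stops,
    and it can only stop at [r]. *)
Lemma dipath_from_root v : exists2 p, path e r p & last r p = v.
Proof.
pose M := \max_(u : T) height u.
have [d] := ubnP (M - height v); elim: d v => // d IHd v lt_d.
have [->|/parent_exists[a eav]] := eqVneq v r; first by exists [::].
have lt_va := height_arc eav.
have le_aM : height a <= M by apply: leq_bigmax.
have [p e_p last_p] : exists2 p, path e r p & last r p = a.
  apply: IHd; rewrite -ltnS; apply: leq_trans lt_d; rewrite ltnS ltn_sub2l //.
  exact: leq_trans lt_va le_aM.
by exists (rcons p v); rewrite ?last_rcons // rcons_path e_p last_p.
Qed.

(** Two paths to the same vertex are compared from their ends, where unique
    parents make them agree; a nonempty path cannot return to [r] because the
    height drops. *)
Lemma dipath_from_root_unique p q :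
  path e r p -> path e r q -> last r p = last r q -> p = q.
Proof.
have loop s y : path e r (rcons s y) -> r = y -> False.
  move=> /(height_path height_arc)/allP/(_ y); rewrite mem_rcons mem_head => /(_ isT) lt_yr.
  by move=> r_y; rewrite r_y ltnn in lt_yr.
elim/last_ind: p q => [|p y IHp] q; elim/last_ind: q => [|q z _] //.
- by move=> _ e_q; rewrite last_rcons => /loop; case/(_ _ e_q).
- by move=> e_p _; rewrite last_rcons => /esym/loop; case/(_ _ e_p).
rewrite !rcons_path !last_rcons => /andP[e_p ey] /andP[e_q ez] def_z.
by rewrite -def_z in ez *; rewrite (IHp q) // (parent_unique ey ez).
Qed.

(** On a cycle with at least three vertices, both neighbours of a lowest vertex
    would be parents of it. *)
Lemma underlying_acyclic p : cycle (underlying e) p -> uniq p -> size p <= 2.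
Proof.
case: p => // x0 p0; set p := x0 :: p0 => cyc_p uniq_p.
have [x x_p x_min] : exists2 x, x \in p & {in p, forall y, height x <= height y}.
  by case: (@arg_minnP _ x0 (mem p) height) => [|x]; [apply: mem_head | exists x].
have [i q def_q] := rot_to x_p.
have q_p y : y \in x :: q -> y \in p by rewrite -def_q mem_rot.
rewrite -(size_rot i) def_q; move: cyc_p uniq_p.
rewrite -(rot_cycle i) -(rot_uniq i) def_q.
have up y : y \in x :: q -> underlying e x y -> e y x.
  move/q_p/x_min => le_xy /orP[/height_arc|//].
  by rewrite ltnNge le_xy.
case: q {def_q q_p} up => [|y q] //; case/lastP: q => [|q z] // up.
rewrite /= rcons_path last_rcons => /and3P[/up e_yx _ xz] /and3P[_ y_q _].
have /up e_zx : z \in [:: x, y & rcons q z] by rewrite !inE mem_rcons mem_head !orbT.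
have def_y : y = z.
  apply: (@parent_unique y z x); first by rewrite e_yx // !inE eqxx orbT.
  by apply: e_zx; rewrite [underlying _ _ _]orbC.
by rewrite def_y mem_rcons mem_head in y_q.
Qed.

Lemma arborescence_of_unique_parents : arborescence e.
Proof.
split; last first.
  exists r => v; have [p e_p last_p] := dipath_from_root v.
  exists p; split=> [|q [[e_q _] last_q]]; first by split=> //; apply: path_is_dipath.
  by apply: dipath_from_root_unique; rewrite ?last_p.
have e_sym : symmetric (underlying e) by move=> x y; apply: orbC.
split=> [x y /height_arc lt_yx|x y|]; last exact: underlying_acyclic.
  by apply/negP=> /height_arc; rewrite ltnNge ltnW.
have conn v : connect (underlying e) r v.
  have [p e_p last_p] := dipath_from_root v; apply/connectP; exists p => //.
  by apply: sub_path e_p => a b e_ab; apply/orP; left.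
apply: connect_trans (conn y); rewrite sym_connect_sym //; exact: conn.
Qed.

End UniqueParents.

(** * Histories of a presentation *)

(** A history lists, for each vertex in order of arrival, its out-neighbours;
    a vertex is named by its arrival time, so that extending a history changes
    neither the names nor the out-neighbours of the earlier vertices. *)
Definition history := seq (seq nat).

Definition arc (H : history) : rel nat := fun a b => b \in nth [::] H a.

Definition wf_history (H : history) : Prop :=
  (forall a b, arc H a b -> b < a) /\
  (forall a a' b, arc H a b -> arc H a' b -> a = a').

Definition is_root (H : history) (v : nat) : Prop :=
  v < size H /\ forall a, ~~ arc H a v.

(** The exempt vertex, the last to arrive, is the root of the arborescence. *)
Definition complete_history (H : history) : Prop :=
  forall b, b.+1 < size H -> exists a, arc H a b.

Lemma arc_size H a b : arc H a b -> a < size H.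
Proof. by rewrite /arc; case: (ltnP a (size H)) => // /(nth_default [::]) ->. Qed.

Lemma arc_cat H S a b : a < size H -> arc (H ++ S) a b = arc H a b.
Proof. by rewrite /arc nth_cat => ->. Qed.

Lemma arc_rcons H R a b :
  arc (rcons H R) a b = arc H a b || (a == size H) && (b \in R).
Proof.
rewrite /arc nth_rcons; have [lt_aH|gt_aH|->] := ltngtP a (size H).
- by rewrite orbF.
- by rewrite (nth_default _ (ltnW gt_aH)).
- by rewrite nth_default.
Qed.

Lemma wf_rcons H R :
  wf_history H -> (forall v, v \in R -> is_root H v) -> wf_history (rcons H R).
Proof.
move=> [arc_lt arc_inj] rootR; split=> [a b|a a' b]; rewrite !arc_rcons.
  by case/orP=> [/arc_lt//|/andP[/eqP-> /rootR[]]].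
case/orP=> [Hab|/andP[/eqP-> /rootR[_ root_b]]].
  case/orP=> [/(arc_inj _ _ _ Hab)//|/andP[_ /rootR[_ /(_ a)]]].
  by rewrite Hab.
by case/orP=> [Ha'b|/andP[/eqP-> _]//]; have := root_b a'; rewrite Ha'b.
Qed.

(** The missing in-neighbours are supplied by one last vertex, placed above all
    the current roots. *)
Lemma completion H :
  wf_history H -> exists S, wf_history (H ++ S) /\ complete_history (H ++ S).
Proof.
move=> wfH; pose R := [seq v <- iota 0 (size H) | v \notin flatten H].
have arc_flatten a v : arc H a v -> v \in flatten H.
  by move=> Hav; apply/flattenP; exists (nth [::] H a); rewrite ?mem_nth ?(arc_size Hav).
have flatten_arc v : v \in flatten H -> exists a, arc H a v.
  by case/flattenP=> C /(nthP [::])[a _ <-] Hav; exists a.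
exists [:: R]; rewrite cats1; split.
  apply: wf_rcons => // v; rewrite mem_filter mem_iota /= => /andP[root_v lt_v].
  by split=> // a; apply: contra root_v; apply: arc_flatten.
move=> b; rewrite size_rcons ltnS => lt_b.
have [/flatten_arc[a Hab]|root_b] := boolP (b \in flatten H).
  by exists a; rewrite arc_rcons Hab.
by exists (size H); rewrite arc_rcons eqxx mem_filter root_b mem_iota lt_b orbT.
Qed.

Definition tree_of (H : history) : rel 'I_(size H) := fun a b => arc H a b.

Lemma tree_arborescence H :
  wf_history H -> complete_history H -> 0 < size H -> arborescence (@tree_of H).
Proof.
move=> [arc_lt arc_inj] complH H_gt0.
have ltr : (size H).-1 < size H by rewrite prednK.
apply: (@arborescence_of_unique_parents _ _ val (Ordinal ltr)).
- by move=> a b; apply: arc_lt.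
- by move=> a a' b Hab Ha'b; apply/val_inj/(arc_inj _ _ _ Hab).
move=> b neq_b; have [|a Hab] := complH b.
  rewrite -[X in _ < X](prednK H_gt0) ltnS ltn_neqAle -[b <= _]ltnS prednK //.
  by rewrite ltn_ord andbT; apply: contraNneq neq_b => eq_b; apply/eqP/val_inj.
by exists (Ordinal (arc_size Hab)).
Qed.

Lemma tree_leaf_to_root H :
  wf_history H -> leaf_to_root_order (@tree_of H) (ord_tuple (size H)).
Proof.
move=> [arc_lt _]; split=> [|x|i j]; rewrite ?val_ord_tuple ?enum_uniq ?mem_enum //.
by rewrite !tnth_ord_tuple => /arc_lt.
Qed.

Lemma presented_tree H j (le_jH : j <= size H) :
  presented (@tree_of H) (ord_tuple (size H)) le_jH = fun a b => arc H a b.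
Proof.
do 2![apply: functional_extensionality => ?].
by rewrite /presented /tree_of !tnth_ord_tuple.
Qed.

(** * Profiles *)

Section Algorithm.
Variables (k : nat) (A : semi_online_algorithm k).

(** The colour of [v] after [j] steps, with a natural number [v] instead of an
    ordinal so that colours at different steps can be compared. *)
Definition colour (H : history) (j v : nat) : option 'I_k :=
  oapp (colouring A (fun a b : 'I_j => arc H a b)) None (insub v).

Lemma colour_ord H j (v : 'I_j) :
  colour H j v = colouring A (fun a b : 'I_j => arc H a b) v.
Proof. by rewrite /colour valK. Qed.

Lemma colour_cat H S j v : j <= size H -> colour (H ++ S) j v = colour H j v.
Proof.
move=> le_jH; rewrite /colour; congr (oapp (colouring A _) None _).
do 2![apply: functional_extensionality => ?].
by rewrite arc_cat // (leq_trans _ le_jH).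
Qed.

Lemma colour_irrevocable H i j v c :
    wf_history H -> complete_history H -> i <= j -> j <= size H ->
  colour H i v = Some c -> colour H j v = Some c.
Proof.
move=> wfH complH /subnK <-; elim: (j - i) => // d IHd lt_dH.
move=> /(IHd (ltnW lt_dH)); rewrite {1}/colour; case: insubP => //= u _ <- col_u.
have arbH := tree_arborescence wfH complH (leq_ltn_trans (leq0n _) lt_dH).
have := @colouring_irrevocable k A _ _ _ _ arbH (tree_leaf_to_root wfH) _ lt_dH u c.
rewrite !presented_tree => /(_ col_u) <-.
exact: (colour_ord H (widen_ord (leqnSn (d + i)) u)).
Qed.

Fixpoint profile_type (d : nat) : finType :=
  if d is d'.+1 then (option 'I_k * {set profile_type d'})%type : finType
  else option 'I_k.

(** The set of profiles of the children ignores their order, multiplicity and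
    number: this is what keeps the profile types finite. *)
Fixpoint profile_at (H : history) (j d y : nat) : profile_type d :=
  if d is d'.+1 then
    (colour H j y, [set q in map (profile_at H j d') (nth [::] H y)])
  else colour H j y.

Definition profile (m : nat) (H : history) (x : nat) : profile_type m :=
  profile_at H x.+1 m x.

Definition has_twins (m : nat) (H : history) : Prop :=
  exists x v, arc H x v /\ profile m H x = profile m H v.

Lemma profile_cat m H S x :
  wf_history H -> x < size H -> profile m (H ++ S) x = profile m H x.
Proof.
move=> [arc_lt _] lt_xH; rewrite /profile.
have agree d y : y <= x -> profile_at (H ++ S) x.+1 d y = profile_at H x.+1 d y.
  elim: d y => [|d IHd] y le_yx /=; rewrite colour_cat //.
  congr (_, _); rewrite nth_cat (leq_ltn_trans le_yx lt_xH).
  rewrite (_ : map _ _ = map (profile_at H x.+1 d) (nth [::] H y)) //.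
  apply/eq_in_map => z /arc_lt lt_zy.
  exact/IHd/(leq_trans (ltnW lt_zy)).
exact: agree.
Qed.

Lemma has_twins_cat m H S : wf_history H -> has_twins m H -> has_twins m (H ++ S).
Proof.
move=> wfH [x [v [Hxv eq_xv]]]; have lt_xH := arc_size Hxv.
have lt_vx := wfH.1 _ _ Hxv.
by exists x, v; rewrite arc_cat // !profile_cat // (ltn_trans lt_vx).
Qed.

(** Each colour on the path moves one step down: the colour of [y] after the
    arrival of [x] is that of [y'] after the earlier arrival of [v], and [y']
    keeps it until [x] arrives.  Equality of the sets of profiles of the
    children, applied to the child [y'] of [y], provides the next pair. *)
Lemma profile_match_path H x v d y y' :
    wf_history H -> complete_history H -> x < size H -> v <= x -> arc H y y' ->
    profile_at H x.+1 d y = profile_at H v.+1 d y' ->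
  exists p, [/\ size p = d, path (arc H) y p &
    forall u c, u \in y :: p -> colour H x.+1 u = Some c ->
      colour H x.+1 (last y p) = Some c].
Proof.
move=> wfH complH lt_xH le_vx; elim: d y y' => [|d IHd] y y' Hyy'.
  by exists [::]; split=> // u c; rewrite inE => /eqP->.
move=> /= [eq_col eq_set].
have: profile_at H x.+1 d y' \in [set q in map (profile_at H v.+1 d) (nth [::] H y')].
  by rewrite -eq_set inE map_f.
rewrite inE => /mapP[y'' Hy'y'' /(IHd _ _ Hy'y'')[p [sz_p H_p col_p]]].
exists (y' :: p); split=> [||u c]; rewrite /= ?sz_p ?Hyy' //.
rewrite inE => /predU1P[->|/col_p]; last exact.
rewrite eq_col => col_y'; apply: col_p (mem_head _ _) _.
exact: colour_irrevocable col_y'.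
Qed.

(** All coloured vertices of the path share the colour of its last vertex. *)
Lemma twins_one_colour_path m H :
    wf_history H -> complete_history H -> has_twins m H ->
  exists (j : nat) (le_jn : j <= size H) (x : 'I_j) (p : seq 'I_j),
    let g := presented (@tree_of H) (ord_tuple (size H)) le_jn in
    [/\ is_dipath g x p, size p = m & at_most_one_colour (colouring A g) (x :: p)].
Proof.
move=> wfH complH [x [v [Hxv eq_xv]]]; have lt_xH := arc_size Hxv.
have [arc_lt _] := wfH.
have [p [sz_p H_p col_p]] :=
  profile_match_path wfH complH lt_xH (ltnW (arc_lt _ _ Hxv)) Hxv eq_xv.
have le_p : all (fun y => y < x.+1) (x :: p).
  rewrite /= leqnn; apply: sub_all (height_path (height := id) arc_lt H_p).
  by move=> y /ltnW.
have [q val_q] : exists q : seq 'I_x.+1, map val q = x :: p.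
  exists (map inord (x :: p)); rewrite -map_comp -[RHS]map_id.
  by apply/eq_in_map => y /(allP le_p) lt_y; rewrite /= inordK.
case: q val_q => //= x' q [val_x' val_q].
exists x.+1, lt_xH, x', q => /=; rewrite presented_tree; split.
- apply: (@path_is_dipath _ _ val) => [a b|]; first exact: arc_lt.
  by have := H_p; rewrite -val_q -[X in path _ X]val_x' path_map.
- by rewrite -sz_p -val_q size_map.
have col_q (u : 'I_x.+1) c : u \in x' :: q ->
    colouring A (fun a b : 'I_x.+1 => arc H a b) u = Some c ->
  colour H x.+1 (last x p) = Some c.
  move=> u_q; rewrite -colour_ord; apply: col_p.
  by rewrite -val_q -[X in X :: _]val_x' -map_cons map_f.
move=> u w c d /col_q col_u /col_q col_w /col_u last_c /col_w.
by rewrite last_c => - [].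
Qed.

(** * Forcing many profiles *)

(** This keeps the roots that arrived before time [b] available as roots. *)
Definition closed_above (b : nat) (H : history) : Prop :=
  forall a c, b <= a -> arc H a c -> b <= c.

Definition distinct_roots (m b : nat) (H : history) (R : seq nat) : Prop :=
  uniq (map (profile m H) R) /\ forall v, v \in R -> b <= v /\ is_root H v.

Lemma distinct_roots_cat m b H S R :
    wf_history H -> closed_above (size H) (H ++ S) ->
  distinct_roots m b H R -> distinct_roots m b (H ++ S) R.
Proof.
move=> wfH closedS [uniqR rootR]; split.
  rewrite (_ : map _ R = map (profile m H) R) //.
  by apply/eq_in_map=> v /rootR[_ [lt_v _]]; apply: profile_cat.
move=> v /rootR[le_bv [lt_vH root_v]]; split=> //.
split=> [|a]; first by rewrite size_cat ltn_addr.
have [lt_aH|le_Ha] := ltnP a (size H); first by rewrite arc_cat.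
by apply/negP=> /(closedS _ _ le_Ha); rewrite leqNgt lt_vH.
Qed.

(** The step from [t] to [t + 1] distinct profiles.  Either [R2] has a root whose
    profile is new to [R1], or a vertex placed above all of [R1] has a profile
    shared by one of its children, or new to [R1] and hence to [R2]. *)
Lemma merge_roots m b H R1 R2 :
    wf_history H -> closed_above b H -> b <= size H ->
    distinct_roots m b H R1 -> distinct_roots m b H R2 ->
    size R1 = size R2 -> (forall v, v \in R1 -> v \notin R2) ->
  exists S, [/\ wf_history (H ++ S), closed_above b (H ++ S) &
    has_twins m (H ++ S) \/
    exists2 R, size R = (size R2).+1 & distinct_roots m b (H ++ S) R].
Proof.
move=> wfH closedH le_bH [uniq1 root1] [uniq2 root2] sz12 disj.
have [sub21|/allPn[_ /mapP[y R2y ->] new_y]] :=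
    boolP (all (mem (map (profile m H) R1)) (map (profile m H) R2)); last first.
  exists [::]; rewrite cats0; split=> //; right; exists (y :: R1).
    by rewrite /= sz12.
  split=> [|v]; first by rewrite /= uniq1 andbT.
  by rewrite inE => /predU1P[->|]; [apply: root2 | apply: root1].
exists [:: R1]; rewrite cats1.
have wf' : wf_history (rcons H R1) by apply: wf_rcons => // v /root1[].
have prof' v : v < size H -> profile m (rcons H R1) v = profile m H v.
  by rewrite -cats1; apply: profile_cat.
split=> // [a c le_ba|].
  by rewrite arc_rcons => /orP[|/andP[_ /root1[]//]]; apply: closedH.
have [/mapP[v R1v eq_xv]|new_x] :=
    boolP (profile m (rcons H R1) (size H) \in map (profile m H) R1).
  left; exists (size H), v; rewrite arc_rcons eqxx R1v orbT; split=> //.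
  by rewrite eq_xv prof' //; case: (root1 v R1v) => _ [].
right; exists (size H :: R2) => //; split.
  have eq2 : map (profile m (rcons H R1)) R2 = map (profile m H) R2.
    by apply/eq_in_map=> v /root2[_ [lt_v _]]; apply: prof'.
  by rewrite /= eq2 uniq2 andbT; apply: contra new_x => /(allP sub21).
move=> v; rewrite inE => /predU1P[->|R2v].
  split=> //; split=> [|a]; first by rewrite size_rcons.
  apply/negP=> Hax; have := wf'.1 _ _ Hax.
  by rewrite ltnNge -ltnS -(size_rcons H R1) (arc_size Hax).
have [le_v [lt_v root_v]] := root2 v R2v.
split=> //; split=> [|a]; first by rewrite size_rcons ltnW.
rewrite arc_rcons negb_or root_v; apply/negP=> /andP[_ /disj].
by rewrite R2v.
Qed.

(** Quantifying over the history already present lets the strategy be played a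
    second time beside the outcome of the first. *)
Lemma force_distinct_roots m t H : wf_history H ->
  exists S, [/\ wf_history (H ++ S), closed_above (size H) (H ++ S) &
    has_twins m (H ++ S) \/
    exists2 R, size R = t & distinct_roots m (size H) (H ++ S) R].
Proof.
elim: t H => [|t IHt] H wfH.
  exists [::]; rewrite cats0; split=> // [a c le_Ha /arc_size|].
    by rewrite ltnNge le_Ha.
  by right; exists [::].
have [S1 [wf1 closed1 [tw1|[R1 sz1 dist1]]]] := IHt H wfH.
  by exists S1; split=> //; left.
have [S2 [wf2 closed2 fin2]] := IHt _ wf1.
have le_sz : size H <= size (H ++ S1) by rewrite size_cat leq_addr.
have closed12 : closed_above (size H) ((H ++ S1) ++ S2).
  move=> a c le_Ha; have [lt_a|le_a] := ltnP a (size (H ++ S1)).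
    by rewrite arc_cat //; apply: closed1.
  by move/(closed2 _ _ le_a); apply: leq_trans.
case: fin2 => [tw2|[R2 sz2 [uniq2 root2]]].
  by exists (S1 ++ S2); rewrite catA; split=> //; left.
have dist2 : distinct_roots m (size H) ((H ++ S1) ++ S2) R2.
  by split=> // v /root2[le_v root_v]; split=> //; apply: leq_trans le_v.
have [| |v|S3 [wf3 closed3 fin3]] := merge_roots wf2 closed12 _
    (distinct_roots_cat wf1 closed2 dist1) dist2.
- by rewrite size_cat (leq_trans le_sz) ?leq_addr.
- by rewrite sz1 sz2.
- move=> /dist1.2[_ [lt_v _]]; apply/negP=> /root2[le_v _].
  by rewrite leqNgt lt_v in le_v.
by exists (S1 ++ S2 ++ S3); rewrite !catA; rewrite sz2 in fin3.
Qed.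

Lemma force_twins m : exists H, wf_history H /\ has_twins m H.
Proof.
have wf0 : wf_history [::] by split=> [a b|a a' b] /arc_size.
have [H [wfH _ [tw|[R szR [uniqR _]]]]] :=
  force_distinct_roots m #|profile_type m|.+1 wf0; first by exists H.
have := max_card (mem (map (profile m H) R)).
by rewrite (card_uniqP uniqR) size_map szR ltnn.
Qed.

End Algorithm.

Theorem theorem1p4 (k m : nat) (k_gt0 : 0 < k) (m_gt0 : 0 < m)
    (A : semi_online_algorithm k) :
  exists (T : finType) (e : rel T) (n : nat) (s : n.-tuple T),
    [/\ arborescence e,
        leaf_to_root_order e s
      & exists (j : nat) (le_jn : j <= n) (x : 'I_j) (p : seq 'I_j),
          [/\ is_dipath (presented e s le_jn) x p,
              size p = m
            & at_most_one_colour (colouring A (presented e s le_jn)) (x :: p)]].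
Proof.
have [H [wfH twH]] := force_twins A m.
have [S [wfS complS]] := completion wfH.
have twS := has_twins_cat S wfH twH.
have S_gt0 : 0 < size (H ++ S).
  by case: twS => x [v [/arc_size lt_x _]]; apply: leq_ltn_trans lt_x.
exists _, (@tree_of (H ++ S)), _, (ord_tuple _); split.
- exact: tree_arborescence.
- exact: tree_leaf_to_root.
exact: twins_one_colour_path twS.
Qed.
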